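(* Let $\mathcal{V}$ be a variety with $\vec 0$ \& $\vec 1$ (with $\vec 0,\vec 1$ tuples of $l$ closed terms). Then $\mathcal{V}$ has the Left Determining Property if and only if there exist positive integers $k$, $n$, with $N:=2k$, terms $s_i$ and $t_i$ of arity $2i+l$ for each $i=1,\dots,n$, and, for every word $\alpha$ in the alphabet $\{1,\dots,N\}$ of length $|\alpha|\le N$, terms $L_\alpha=L_\alpha(\vec X)$, $R_\alpha=R_\alpha(\vec X)$ in the variables $\vec X=(x,y,\vec z,x_1,y_1,\dots,x_n,y_n)$ (with $\vec z=(z_1,\dots,z_l)$), such that the following identities hold in $\mathcal{V}$, where $\sigma,\sigma^*,\rho,\rho^*$ are the functions on $T(\vec X)$ determined by the $s_i,t_i$ as in the context. Case $|\alpha|=N$: $$L_\alpha(\rho(\vec X))\approx R_\alpha(\rho(\vec X)),\qquad L_\alpha(\rho^*(\vec X))\approx R_\alpha(\rho^*(\vec X)).$$ Case $|\alpha|=0$ (with $\varepsilon$ the empty word): $$x\approx L_\varepsilon(\vec X),\qquad R_\varepsilon(\vec X)\approx y,$$ $$L_\varepsilon(\rho(\vec X))\approx L_1(\rho(\vec X)),\qquad R_j(\rho(\vec X))\approx L_{j+1}(\rho(\vec X))\ \ (1\le j\le N-1),\qquad R_N(\rho(\vec X))\approx R_\varepsilon(\rho(\vec X)).$$ Case $0<|\alpha|<N$, $|\alpha|$ even: $$L_\alpha(\rho(\vec X))\approx L_{\alpha1}(\rho(\vec X)),\quad R_{\alpha j}(\rho(\vec X))\approx L_{\alpha(j+1)}(\rho(\vec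 X))\ (1\le j\le k-1),\quad R_{\alpha k}(\rho(\vec X))\approx R_\alpha(\rho(\vec X)),$$ $$L_\alpha(\rho^*(\vec X))\approx L_{\alpha(k+1)}(\rho^*(\vec X)),\quad R_{\alpha j}(\rho^*(\vec X))\approx L_{\alpha(j+1)}(\rho^*(\vec X))\ (k+1\le j\le N-1),\quad R_{\alpha N}(\rho^*(\vec X))\approx R_\alpha(\rho^*(\vec X)).$$ Case $0<|\alpha|<N$, $|\alpha|$ odd: $$L_\alpha(\sigma(\vec X))\approx L_{\alpha1}(\sigma(\vec X)),\quad R_{\alpha j}(\sigma(\vec X))\approx L_{\alpha(j+1)}(\sigma(\vec X))\ (1\le j\le k-1),\quad R_{\alpha k}(\sigma(\vec X))\approx R_\alpha(\sigma(\vec X)),$$ $$L_\alpha(\sigma^*(\vec X))\approx L_{\alpha(k+1)}(\sigma^*(\vec X)),\quad R_{\alpha j}(\sigma^*(\vec X))\approx L_{\alpha(j+1)}(\sigma^*(\vec X))\ (k+1\le j\le N-1),\quad R_{\alpha N}(\sigma^*(\vec X))\approx R_\alpha(\sigma^*(\vec X)).$$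
   Context: A variety with $\vec 0$ \& $\vec 1$ is a variety $\mathcal{V}$ with terms $\vec 0=(0_1,\dots,0_l)$, $\vec 1=(1_1,\dots,1_l)$, assumed closed (variable-free), such that $\mathcal{V}\models\vec 0=\vec 1\to x=y$ ($x,y$ distinct variables). For congruences, $\theta\times\theta^*=\Delta$ means that $\theta,\theta^*$ are complementary factor congruences, i.e. $\theta\cap\theta^*=\Delta$ (the trivial congruence) and $\theta\circ\theta^*=\nabla$ (the universal congruence). For tuples, $\vec a\,\theta\,\vec b$ means $(a_i,b_i)\in\theta$ for all $i$. Left Determining Property: for every $A\in\mathcal{V}$, $\vec e\in A^l$ and congruences $\varphi,\varphi^*,\theta,\theta^*$ of $A$, if $\varphi\times\varphi^*=\Delta$, $\theta\times\theta^*=\Delta$, $\vec 0\,\theta\,\vec e\,\theta^*\,\vec 1$ and $\vec 0\,\varphi\,\vec e\,\varphi^*\,\vec 1$, then $\theta=\varphi$. Given terms $s_i,t_i$ of arity $2i+l$ ($i=1,\dots,n$) and an algebra $A$ in the language of $\mathcal{V}$ (not necessarily in $\mathcal{V}$), the functions $\sigma,\sigma^*,\rho,\rho^*:A^{2+l+2n}\to A^{2+l+2n}$ send $(c,d,\vec e,a_1,b_1,\dots,a_n,b_n)$ to the tuple $(x,y,\vec z,x_1,y_1,\dots,x_n,y_n)$ given recursively ($j=1,\dots,n$) by: - $\sigma$: $x:=c$, $y:=c$, $\vec z:=\vec 0$, $x_j:=s_j(x,y,\vec z,x_1,y_1,\dots,x_{j-1},y_{j-1})$, $y_j:=b_j$;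 - $\sigma^*$: $x:=c$, $y:=d$, $\vec z:=\vec 1$, $x_j:=t_j(x,y,\vec z,x_1,y_1,\dots,x_{j-1},y_{j-1})$, $y_j:=b_j$; - $\rho$: $x:=c$, $y:=d$, $\vec z:=\vec 0$, $x_j:=a_j$, $y_j:=s_j(x,y,\vec z,x_1,y_1,\dots,x_{j-1},y_{j-1})$; - $\rho^*$: $x:=c$, $y:=d$, $\vec z:=\vec 1$, $x_j:=a_j$, $y_j:=t_j(x,y,\vec z,x_1,y_1,\dots,x_{j-1},y_{j-1})$. Here they are applied with $A=T(\vec X)$, the term algebra on $\vec X$, to the tuple of variables $\vec X$, so e.g. $L_\alpha(\rho(\vec X))$ is the result of substituting the tuple of terms $\rho(\vec X)$ for $\vec X$ in $L_\alpha$. For a word $\alpha$ and a letter $j$, $\alpha j$ denotes concatenation; $|\alpha|$ is the length of $\alpha$. *)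

(* Defs.v *)
From Stdlib Require Import RelationClasses FunctionalExtensionality.
From mathcomp Require Import all_boot.
Set Implicit Arguments.
Unset Strict Implicit.
Unset Printing Implicit Defensive.

Record signature := Signature { op : Type; arity : op -> nat }.

Inductive term (S : signature) (X : Type) : Type :=
| Var of X
| App (f : op S) of ('I_(arity f) -> term S X).

Arguments Var {S X} _.
Arguments App {S X} f _.

Record algebra (S : signature) := Algebra {
  carrier :> Type;
  interp : forall f : op S, ('I_(arity f) -> carrier) -> carrier }.

Fixpoint eval (S : signature) (X : Type) (A : algebra S) (v : X -> A)
    (p : term S X) : A :=
  match p with
  | Var x => v x
  | App f ps => interp (fun i => eval v (ps i))
  end.

Definition term_algebra (S : signature) (X : Type) : algebra S :=
  Algebra (fun (f : op S) (ps : 'I_(arity f) -> term S X) => App f ps).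

Definition subst (S : signature) (X Y : Type) (v : X -> term S Y)
    (p : term S X) : term S Y :=
  eval (A := term_algebra S Y) v p.

(* Closed terms are terms over the empty set of variables. *)
Definition eval_closed (S : signature) (A : algebra S) (p : term S void) : A :=
  eval (of_void A) p.

Definition satisfies (S : signature) (X : Type) (A : algebra S)
    (p q : term S X) : Prop :=
  forall v : X -> A, eval v p = eval v q.

(* A variety is the class of all nonempty models of a set of identities, which
   may be written in countably many variables. *)
Definition variety (S : signature) (V : algebra S -> Prop) : Prop :=
  exists E : term S nat -> term S nat -> Prop, forall A : algebra S,
    V A <-> inhabited A /\ forall p q, E p q -> satisfies A p q.

Definition identity (S : signature) (V : algebra S -> Prop) (X : Type)
    (p q : term S X) : Prop :=
  forall A : algebra S, V A -> satisfies A p q.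

Definition variety_with_01 (S : signature) (V : algebra S -> Prop) (l : nat)
    (zero one : 'I_l -> term S void) : Prop :=
  variety V /\
  forall A : algebra S, V A ->
    (forall i, eval_closed A (zero i) = eval_closed A (one i)) ->
    forall x y : A, x = y.

Definition congruence (S : signature) (A : algebra S) (theta : A -> A -> Prop) :
    Prop :=
  Equivalence theta /\
  forall (f : op S) (a b : 'I_(arity f) -> A),
    (forall i, theta (a i) (b i)) -> theta (interp a) (interp b).

Definition complementary_factors (T : Type) (theta theta' : T -> T -> Prop) :
    Prop :=
  (forall a b, theta a b /\ theta' a b <-> a = b) /\
  (forall a b, exists c, theta a c /\ theta' c b).

Definition left_determining (S : signature) (V : algebra S -> Prop) (l : nat)
    (zero one : 'I_l -> term S void) : Prop :=
  forall (A : algebra S) (e : 'I_l -> A) (phi phi' theta theta' : A -> A -> Prop),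
    V A ->
    congruence phi -> congruence phi' ->
    congruence theta -> congruence theta' ->
    complementary_factors phi phi' -> complementary_factors theta theta' ->
    (forall i, theta (eval_closed A (zero i)) (e i)) ->
    (forall i, theta' (e i) (eval_closed A (one i))) ->
    (forall i, phi (eval_closed A (zero i)) (e i)) ->
    (forall i, phi' (e i) (eval_closed A (one i))) ->
    forall a b, theta a b <-> phi a b.

(* The variables x, y, z_1, ..., z_l, x_1, y_1, ..., x_n, y_n; the index sets
   {1, ..., l} and {1, ..., n} are shifted to start at 0.  A tuple in
   A^(2+l+2n) is a function [xvar l n -> A]. *)
Inductive xvar (l n : nat) : Type :=
| VX
| VY
| VZ of 'I_l
| VXs of 'I_n
| VYs of 'I_n.

Arguments VX {l n}.
Arguments VY {l n}.
Arguments VZ {l n} _.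
Arguments VXs {l n} _.
Arguments VYs {l n} _.

(* The terms s_1, ..., s_n.  The entry [s j] is s_(j+1), a term of arity
   2(j+1)+l written in x, y, z, x_1, y_1, ..., x_j, y_j. *)
Definition term_family (S : signature) (l n : nat) : Type :=
  forall j : 'I_n, term S (xvar l j).

(* The indices of the last two branches range over the empty type 'I_0. *)
Definition start (l : nat) (A : Type) (c d : A) (e : 'I_l -> A)
    (u : xvar l 0) : A :=
  match u with
  | VX => c
  | VY => d
  | VZ i => e i
  | VXs _ => c
  | VYs _ => c
  end.

(* Append the pair (a, b) to a tuple. *)
Definition snoc (l n : nat) (A : Type) (w : xvar l n -> A) (a b : A)
    (u : xvar l n.+1) : A :=
  match u with
  | VX => w VX
  | VY => w VY
  | VZ i => w (VZ i)
  | VXs j => if unlift ord_max j is Some i then w (VXs i) else a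
  | VYs j => if unlift ord_max j is Some i then w (VYs i) else b
  end.

(* The tuple that starts with c, d, e and in which, for each j, one of x_j, y_j
   is the value of s_j at all earlier entries (x_j if [on_x], y_j otherwise)
   and the other one is the given g_j; see [extend_solved], [extend_given]. *)
Fixpoint extend (S : signature) (A : algebra S) (l : nat) (on_x : bool)
    (c d : A) (e : 'I_l -> A) (n : nat) :
    term_family S l n -> ('I_n -> A) -> xvar l n -> A :=
  match n with
  | 0 => fun _ _ => start c d e
  | m.+1 => fun s g =>
      let w := extend on_x c d e
                 (fun j : 'I_m => s (widen_ord (leqnSn m) j))
                 (fun j : 'I_m => g (widen_ord (leqnSn m) j)) in
      let a := eval w (s ord_max) in
      if on_x then snoc w a (g ord_max) else snoc w (g ord_max) a
  end.

Definition xvar_widen (l m n : nat) (lemn : m <= n) (u : xvar l m) : xvar l n :=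
  match u with
  | VX => VX
  | VY => VY
  | VZ i => VZ i
  | VXs j => VXs (widen_ord lemn j)
  | VYs j => VYs (widen_ord lemn j)
  end.

Lemma eq_eval (S : signature) (X : Type) (A : algebra S) (v w : X -> A)
    (p : term S X) :
  v =1 w -> eval v p = eval w p.
Proof. by move=> vw; congr (eval _ p); apply: functional_extensionality. Qed.

Lemma extend_start (S : signature) (A : algebra S) (l : nat) (on_x : bool)
    (c d : A) (e : 'I_l -> A) (n : nat) (s : term_family S l n)
    (g : 'I_n -> A) :
  let w := extend on_x c d e s g in
  [/\ w VX = c, w VY = d & forall i, w (VZ i) = e i].
Proof.
elim: n s g => [|m IH] s g; first by split.
have [hx hy hz] := IH (fun j => s (widen_ord (leqnSn m) j))
                      (fun j => g (widen_ord (leqnSn m) j)).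
by rewrite /=; move: hx hy hz; case: (on_x).
Qed.

Lemma extend_given (S : signature) (A : algebra S) (l : nat) (on_x : bool)
    (c d : A) (e : 'I_l -> A) (n : nat) (s : term_family S l n)
    (g : 'I_n -> A) (j : 'I_n) :
  extend on_x c d e s g (if on_x then VYs j else VXs j) = g j.
Proof.
elim: n s g j => [|m IH] s g j; first by case: j.
have liftE i : lift ord_max i = widen_ord (leqnSn m) i.
  by apply/val_inj; rewrite /= /bump leqNgt ltn_ord.
case: (unliftP ord_max j) => [i|] ->.
  have := IH (fun j => s (widen_ord (leqnSn m) j))
             (fun j => g (widen_ord (leqnSn m) j)) i.
  by case: (on_x) => /=; rewrite liftK -liftE.
by case: (on_x) => /=; rewrite unlift_none.
Qed.

Lemma extend_widen (S : signature) (A : algebra S) (l : nat) (on_x : bool)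
    (c d : A) (e : 'I_l -> A) (m : nat) (s : term_family S l m.+1)
    (g : 'I_m.+1 -> A) (u : xvar l m) :
  extend on_x c d e s g (xvar_widen (leqnSn m) u) =
  extend on_x c d e (fun j : 'I_m => s (widen_ord (leqnSn m) j))
    (fun j : 'I_m => g (widen_ord (leqnSn m) j)) u.
Proof.
have liftE i : widen_ord (leqnSn m) i = lift ord_max i.
  by apply/val_inj; rewrite /= /bump leqNgt ltn_ord.
by rewrite /=; case: (on_x); case: u => //= i; rewrite liftE liftK.
Qed.

Lemma extend_solved (S : signature) (A : algebra S) (l : nat) (on_x : bool)
    (c d : A) (e : 'I_l -> A) (n : nat) (s : term_family S l n)
    (g : 'I_n -> A) (j : 'I_n) :
  let w := extend on_x c d e s g in
  w (if on_x then VXs j else VYs j) =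
  eval (fun u : xvar l j => w (xvar_widen (ltnW (ltn_ord j)) u)) (s j).
Proof.
elim: n s g j => [|m IH] s g j; first by case: j.
have liftE i : lift ord_max i = widen_ord (leqnSn m) i.
  by apply/val_inj; rewrite /= /bump leqNgt ltn_ord.
have widenE (i : nat) (le1 : i <= m) (le2 : i <= m.+1) (u : xvar l i) :
    xvar_widen le2 u = xvar_widen (leqnSn m) (xvar_widen le1 u).
  by case: u => //= a; congr (_ _); apply/val_inj.
case: (unliftP ord_max j) => [i|] ->.
  rewrite liftE /=.
  have := IH (fun j => s (widen_ord (leqnSn m) j))
             (fun j => g (widen_ord (leqnSn m) j)) i.
  set w := extend _ _ _ _ _ _ => /= IHi.
  transitivity (w (if on_x then VXs i else VYs i)).
    by rewrite /w; case: (on_x) => /=; rewrite -liftE liftK.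
  rewrite IHi; apply: eq_eval => u.
  rewrite (widenE _ (ltnW (ltn_ord i))).
  exact/esym/(extend_widen on_x c d e s g).
transitivity (eval (extend on_x c d e
    (fun j : 'I_m => s (widen_ord (leqnSn m) j))
    (fun j : 'I_m => g (widen_ord (leqnSn m) j))) (s ord_max)).
  by rewrite /w /=; case: (on_x) => /=; rewrite unlift_none.
apply: (@eq_eval S (xvar l m)) => u; rewrite -(extend_widen on_x c d e s g).
by congr (extend _ _ _ _ _ _ _); case: u => //= a; congr (_ _); apply/val_inj.
Qed.

Definition sigma (S : signature) (l : nat) (A : algebra S)
    (zero : 'I_l -> term S void) (n : nat) (s : term_family S l n)
    (v : xvar l n -> A) : xvar l n -> A :=
  extend true (v VX) (v VX) (fun i => eval_closed A (zero i)) s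
    (fun j => v (VYs j)).

Definition sigma_star (S : signature) (l : nat) (A : algebra S)
    (one : 'I_l -> term S void) (n : nat) (t : term_family S l n)
    (v : xvar l n -> A) : xvar l n -> A :=
  extend true (v VX) (v VY) (fun i => eval_closed A (one i)) t
    (fun j => v (VYs j)).

Definition rho (S : signature) (l : nat) (A : algebra S)
    (zero : 'I_l -> term S void) (n : nat) (s : term_family S l n)
    (v : xvar l n -> A) : xvar l n -> A :=
  extend false (v VX) (v VY) (fun i => eval_closed A (zero i)) s
    (fun j => v (VXs j)).

Definition rho_star (S : signature) (l : nat) (A : algebra S)
    (one : 'I_l -> term S void) (n : nat) (t : term_family S l n)
    (v : xvar l n -> A) : xvar l n -> A :=
  extend false (v VX) (v VY) (fun i => eval_closed A (one i)) t
    (fun j => v (VXs j)).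

(* Words in the alphabet {1, ..., N}. *)
Definition word (N : nat) (alpha : seq nat) : bool :=
  all (fun j => 1 <= j <= N) alpha.

(* Main.v *)
(* Sufficiency.  Given (c,d) in theta, solve s_j theta x_j theta' t_j and
   s_j phi y_j phi' t_j successively, starting from x = c, y = d, z = e.  The
   tuple so obtained is theta-, theta'-, phi-, phi'-related to its images under
   sigma, sigma^*, rho, rho^*, so a descending induction on |alpha| gives
   L_alpha = R_alpha at it for alpha nonempty, and the chain at the empty word
   then reads (c,d) in phi.

   Necessity.  Let F be the term algebra on x, y, z closed under adding, for any
   two terms p and q, variables that witness p sigma . sigma^* q and
   p rho . rho^* q.  Let D be the least congruence containing the identities of
   V such that D is the intersection of its joins with sigma and sigma^*, and
   also of its joins with rho and rho^*.  In F / D both pairs are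
   complementary factor congruences which move 0 to z and z to 1, and sigma
   identifies x and y; hence so does rho.  The finite certificate of this fact
   is a tree of pairs (L_alpha, R_alpha), in which only finitely many witness
   variables occur, and these can be listed so that each comes after the
   variables of the terms p and q that it joins. *)
From HB Require Import structures.
From Stdlib Require Import RelationClasses.
Require Import Defs.
From mathcomp Require Import all_boot.
From mathcomp Require Import boolp.
Set Implicit Arguments.
Unset Strict Implicit.
Unset Printing Implicit Defensive.

(** * Evaluation and substitution of terms *)

Section Terms.
Variables (S : signature) (X : Type).

Fixpoint occurs (x : X) (p : term S X) : Prop :=
  match p with
  | Var y => y = x
  | App f ps => exists i, occurs x (ps i)
  end.

Lemma eval_subst (Y : Type) (A : algebra S) (v : Y -> A) (f : X -> term S Y)
    (p : term S X) :
  eval v (subst f p) = eval (fun x => eval v (f x)) p.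
Proof. by elim: p => //= g ps IH; congr interp; apply: funext. Qed.

Lemma eval_occurs (A : algebra S) (v w : X -> A) (p : term S X) :
  (forall x, occurs x p -> v x = w x) -> eval v p = eval w p.
Proof.
elim: p => [x|f ps IH] vw /=; first exact: vw.
by congr interp; apply: funext => i; apply: IH => x px; apply: vw; exists i.
Qed.

Lemma eval_congr (A : algebra S) (D : A -> A -> Prop) (v w : X -> A)
    (p : term S X) :
  congruence D -> (forall x, D (v x) (w x)) -> D (eval v p) (eval w p).
Proof. by move=> [eqD DS] vw; elim: p => //= f ps IH; apply: DS. Qed.

End Terms.

Lemma eval_eval_closed (S : signature) (X : Type) (A : algebra S)
    (v : X -> A) (p : term S void) :
  eval v (eval_closed (term_algebra S X) p) = eval_closed A p.
Proof.
by rewrite [LHS](eval_subst v (of_void _)); apply: eval_occurs => -[].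
Qed.

(** Evaluation is a homomorphism on the term algebra and [extend] applies only terms, so the two
    commute. *)
Lemma eval_extend (S : signature) (Y : Type) (A : algebra S) (v : Y -> A)
    (l : nat) (b : bool) (c d : term S Y) (e : 'I_l -> term S Y) (n : nat)
    (s : term_family S l n) (g : 'I_n -> term S Y) (u : xvar l n) :
  eval v (extend (A := term_algebra S Y) b c d e s g u) =
  extend b (eval v c) (eval v d) (fun i => eval v (e i)) s
    (fun j => eval v (g j)) u.
Proof.
elim: n s g u => [|n IH] s g u; first by case: u.
have snocE (w : xvar l n -> term S Y) a a' :
    eval v (snoc w a a' u) = snoc (eval v \o w) (eval v a) (eval v a') u.
  by case: u => //= j; case: unlift.
rewrite /=; set w := extend _ _ _ _ _ _; set w' := extend _ _ _ _ _ _.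
have ww' : eval v \o w = w' by apply: funext => x; apply: IH.
have evw : eval v (eval (A := term_algebra S Y) w (s ord_max)) =
           eval w' (s ord_max).
  by rewrite -ww'; apply: eval_subst.
by case: (b); rewrite snocE ww' evw.
Qed.

(* With ([on_x], [ident]) = (true, true), (true, false), (false, false),
   (false, false) this is sigma, sigma^*, rho, rho^*, where [z], [s] stand for
   [one], [t] in the starred cases. *)
Definition solve (S : signature) (l : nat) (A : algebra S) (on_x ident : bool)
    (z : 'I_l -> term S void) (n : nat) (s : term_family S l n)
    (v : xvar l n -> A) : xvar l n -> A :=
  extend on_x (v VX) (if ident then v VX else v VY)
    (fun i => eval_closed A (z i)) s (fun j => v (if on_x then VYs j else VXs j)).

(** * Solved tuples and congruences *)

Section Solve.
Variables (S : signature) (l : nat) (on_x ident : bool).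
Variables (z : 'I_l -> term S void) (n : nat) (s : term_family S l n).

Lemma eval_solve (A : algebra S) (v : xvar l n -> A) (p : term S (xvar l n)) :
  eval v (subst (solve (A := term_algebra S _) on_x ident z s Var) p) =
  eval (solve on_x ident z s v) p.
Proof.
rewrite eval_subst; apply: eval_occurs => u _; rewrite eval_extend /solve.
have -> : (fun i => eval v (eval_closed (term_algebra S (xvar l n)) (z i))) =
          (fun i => eval_closed A (z i)).
  by apply: funext => i; apply: eval_eval_closed.
by case: (ident).
Qed.

(** The hypotheses say that [v] satisfies the equations of a solved tuple modulo [D]. Given entries
    are copied, and solved ones agree by induction on the index, since [D] is compatible with the
    terms [s j]. *)
Lemma solve_congr (A : algebra S) (D : A -> A -> Prop) (v : xvar l n -> A) :
  congruence D ->
  (ident -> D (v VX) (v VY)) ->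
  (forall i, D (v (VZ i)) (eval_closed A (z i))) ->
  (forall j : 'I_n, D (v (if on_x then VXs j else VYs j))
     (eval (fun u : xvar l j => v (xvar_widen (ltnW (ltn_ord j)) u)) (s j))) ->
  forall u, D (v u) (solve on_x ident z s v u).
Proof.
move=> cD hid hz hs; have [eqD _] := cD.
have [hX hY hZ] := extend_start on_x (v VX) (if ident then v VX else v VY)
  (fun i => eval_closed A (z i)) s (fun j => v (if on_x then VYs j else VXs j)).
have hg := extend_given on_x (v VX) (if ident then v VX else v VY)
  (fun i => eval_closed A (z i)) s (fun j => v (if on_x then VYs j else VXs j)).
have he := extend_solved on_x (v VX) (if ident then v VX else v VY)
  (fun i => eval_closed A (z i)) s (fun j => v (if on_x then VYs j else VXs j)).
rewrite -/(solve on_x ident z s v) in hX hY hZ hg he.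
have DX : D (v VX) (solve on_x ident z s v VX) by rewrite hX; reflexivity.
have DY : D (v VY) (solve on_x ident z s v VY).
  rewrite hY; case: (ident) hid => hid; last reflexivity.
  by symmetry; apply: hid.
have DZ i : D (v (VZ i)) (solve on_x ident z s v (VZ i)) by rewrite hZ.
have Dg j : D (v (if on_x then VYs j else VXs j))
              (solve on_x ident z s v (if on_x then VYs j else VXs j)).
  by rewrite hg; reflexivity.
suff Ds m (j : 'I_n) : j < m -> D (v (if on_x then VXs j else VYs j))
              (solve on_x ident z s v (if on_x then VXs j else VYs j)).
  case=> // j; have {}Ds := Ds _ j (ltnSn j);
  have {}Dg := Dg j; by case: (on_x) Dg Ds.
elim: m j => // m IH j; rewrite ltnS => jm.
rewrite he; transitivity
  (eval (fun u : xvar l j => v (xvar_widen (ltnW (ltn_ord j)) u)) (s j)) => //.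
apply: eval_congr => // -[] //= i.
all: set i' := widen_ord _ i.
all: have {}IH := IH i' (leq_trans (ltn_ord i) jm); have {}Dg := Dg i'.
all: by case: (on_x) Dg IH.
Qed.

Lemma identity_solve (V : algebra S -> Prop) (A : algebra S)
    (D : A -> A -> Prop) (v : xvar l n -> A) (p q : term S (xvar l n)) :
  congruence D -> (forall u, D (v u) (solve on_x ident z s v u)) -> V A ->
  identity V (subst (solve (A := term_algebra S _) on_x ident z s Var) p)
    (subst (solve (A := term_algebra S _) on_x ident z s Var) q) ->
  D (eval v p) (eval v q).
Proof.
move=> cD Dv VA pq; have [eqD _] := cD; have := pq A VA v; rewrite !eval_solve.
move=> epq; transitivity (eval (solve on_x ident z s v) p).
  exact: eval_congr.
by rewrite epq; symmetry; apply: eval_congr.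
Qed.

End Solve.

(** * Sufficiency of the identities *)

(** The index ranges [1..k], [k + 1..N] and [1..N] give the three shapes of chain in the theorem. *)
Definition links (T : Type) (tau : T -> T -> Prop) (L R : seq nat -> T)
    (alpha : seq nat) (lo hi : nat) : Prop :=
  [/\ tau (L alpha) (L (rcons alpha lo)),
      forall j, lo <= j <= hi - 1 ->
        tau (R (rcons alpha j)) (L (rcons alpha (j + 1))) &
      tau (R (rcons alpha hi)) (R alpha)].

Lemma links_glue (T : Type) (tau : T -> T -> Prop) (L R : seq nat -> T)
    (alpha : seq nat) (lo hi : nat) :
  Equivalence tau -> 0 < lo <= hi -> links tau L R alpha lo hi ->
  (forall j, lo <= j <= hi -> L (rcons alpha j) = R (rcons alpha j)) ->
  tau (L alpha) (R alpha).
Proof.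
move=> eqt /andP[lo0 lohi] [tl tm tr] LR.
suff H m : lo + m <= hi -> tau (L alpha) (R (rcons alpha (lo + m))).
  by transitivity (R (rcons alpha hi)) => //; rewrite -(subnKC lohi); apply: H;
    rewrite subnKC.
elim: m => [|m IH] hm; first by rewrite -LR addn0 // leqnn.
transitivity (R (rcons alpha (lo + m))).
  by apply: IH; apply: leq_trans hm; rewrite leq_add2l.
rewrite addnS -(LR (lo + m).+1); last by rewrite -addnS hm leq_addr.
rewrite -addn1; apply: tm; rewrite leq_addr /= subn1 -ltnS.
by rewrite prednK -?addnS // (leq_trans lo0).
Qed.

(** Each requirement involves only earlier entries, so the tuple is chosen one pair at a time. *)
Lemma exists_extension (l : nat) (A : Type) (a b : A) (e : 'I_l -> A) (n : nat)
    (PX PY : forall j : 'I_n, (xvar l j -> A) -> A -> Prop) :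
  (forall j w, exists c, PX j w c) -> (forall j w, exists c, PY j w c) ->
  exists w : xvar l n -> A,
    [/\ w VX = a, w VY = b, forall i, w (VZ i) = e i &
        forall j : 'I_n,
          let wj u := w (xvar_widen (ltnW (ltn_ord j)) u) in
          PX j wj (w (VXs j)) /\ PY j wj (w (VYs j))].
Proof.
elim: n PX PY => [|n IH] PX PY hX hY; first by exists (start a b e); split=> // -[].
pose le := leqnSn n.
have [w [wX wY wZ wP]] := IH (fun j => PX (widen_ord le j))
  (fun j => PY (widen_ord le j)) (fun j => hX (widen_ord le j))
  (fun j => hY (widen_ord le j)).
have [c hc] := hX ord_max w; have [d hd] := hY ord_max w.
exists (snoc w c d); split=> // j.
have liftE i : widen_ord le i = lift ord_max i.
  by apply/val_inj; rewrite /= /bump leqNgt ltn_ord.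
case: (unliftP ord_max j) => [i|] -> {j}.
  rewrite -liftE; set wj := fun u => _.
  have -> : wj = fun u => w (xvar_widen (ltnW (ltn_ord i)) u).
    apply: funext => u; rewrite /wj.
    have H (k : 'I_i) : unlift ord_max (widen_ord (ltnW (ltn_ord (widen_ord le i))) k)
             = Some (widen_ord (ltnW (ltn_ord i)) k).
      rewrite -(liftK ord_max) -liftE; congr (unlift _ _); exact/val_inj.
    by case: u => //= k; rewrite H.
  have un : unlift ord_max (widen_ord le i) = Some i by rewrite liftE liftK.
  by have := wP i; rewrite /= un.
set wj := fun u => _.
have -> : wj = w.
  apply: funext => u; rewrite /wj.
  have H (k : 'I_n) : unlift ord_max (widen_ord (ltnW (ltn_ord ord_max)) k) = Some k.
    rewrite -(liftK ord_max) -liftE; congr (unlift _ _); exact/val_inj.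
  by case: u => //= k; rewrite H.
by rewrite /= unlift_none.
Qed.

(** One inclusion is enough: exchanging the two pairs of congruences gives the other. The four maps
    appear as instances of [solve], which unfold to [sigma], [sigma_star], [rho] and [rho_star]. *)
Lemma left_determining_incl (S : signature) (V : algebra S -> Prop) (l : nat)
    (zero one : 'I_l -> term S void) (k n : nat) (s t : term_family S l n)
    (L R : seq nat -> term S (xvar l n)) :
  let N := 2 * k in
  let T := term_algebra S (xvar l n) in
  let tau on_x id z r p q :=
    identity V (subst (solve (A := T) on_x id z r Var) p)
      (subst (solve (A := T) on_x id z r Var) q) in
  let sg := tau true true zero s in
  let sg' := tau true false one t in
  let rh := tau false false zero s in
  let rh' := tau false false one t in
  0 < k ->
  (forall alpha, word N alpha -> size alpha = N ->
     rh (L alpha) (R alpha) /\ rh' (L alpha) (R alpha)) ->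
  identity V (Var VX) (L [::]) -> identity V (R [::]) (Var VY) ->
  links rh L R [::] 1 N ->
  (forall alpha, word N alpha -> 0 < size alpha < N -> ~~ odd (size alpha) ->
     links rh L R alpha 1 k /\ links rh' L R alpha (k + 1) N) ->
  (forall alpha, word N alpha -> 0 < size alpha < N -> odd (size alpha) ->
     links sg L R alpha 1 k /\ links sg' L R alpha (k + 1) N) ->
  forall (A : algebra S) (e : 'I_l -> A) (phi phi' theta theta' : A -> A -> Prop),
    V A ->
    congruence phi -> congruence phi' ->
    congruence theta -> congruence theta' ->
    complementary_factors phi phi' -> complementary_factors theta theta' ->
    (forall i, theta (eval_closed A (zero i)) (e i)) ->
    (forall i, theta' (e i) (eval_closed A (one i))) ->
    (forall i, phi (eval_closed A (zero i)) (e i)) ->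
    (forall i, phi' (e i) (eval_closed A (one i))) ->
    forall a b, theta a b -> phi a b.
Proof.
move=> N T tau sg sg' rh rh' k0 Htop Hx Hy Hroot Heven Hodd.
move=> A e phi phi' theta theta' VA cp cp' ct ct' [pI pC] [tI tC] t0 t1 p0 p1.
move=> a b tab.
have [eqp _] := cp; have [eqp' _] := cp'.
have [eqt _] := ct; have [eqt' _] := ct'.
have [w [wX wY wZ wP]] := @exists_extension l A a b e n
  (fun j w c => theta (eval w (s j)) c /\ theta' c (eval w (t j)))
  (fun j w c => phi (eval w (s j)) c /\ phi' c (eval w (t j)))
  (fun j w => tC _ _) (fun j w => pC _ _).
(* The map sigma puts x in the place of y; this is where [theta a b] enters. *)
have Dsg p q : sg p q -> theta (eval w p) (eval w q).
  apply: identity_solve => //; apply: solve_congr => //.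
  - by rewrite wX wY.
  - by move=> i; rewrite wZ; symmetry.
  - by move=> j; symmetry; have [[]] := wP j.
have Dsg' p q : sg' p q -> theta' (eval w p) (eval w q).
  apply: identity_solve => //; apply: solve_congr => //.
  - by move=> i; rewrite wZ.
  - by move=> j; have [[]] := wP j.
have Drh p q : rh p q -> phi (eval w p) (eval w q).
  apply: identity_solve => //; apply: solve_congr => //.
  - by move=> i; rewrite wZ; symmetry.
  - by move=> j; symmetry; have [_ []] := wP j.
have Drh' p q : rh' p q -> phi' (eval w p) (eval w q).
  apply: identity_solve => //; apply: solve_congr => //.
  - by move=> i; rewrite wZ.
  - by move=> j; have [_ []] := wP j.
pose L' := eval w \o L; pose R' := eval w \o R.
have elinks (tau1 : term S _ -> term S _ -> Prop) (tau2 : A -> A -> Prop) al lo hi :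
    (forall p q, tau1 p q -> tau2 (eval w p) (eval w q)) ->
    links tau1 L R al lo hi -> links tau2 L' R' al lo hi.
  by move=> t12 [h1 h2 h3]; split=> [|j hj|]; apply: t12 => //; apply: h2.
have kN : k + 1 <= N by rewrite /N mul2n -addnn leq_add2l.
have k1N : k <= N by apply: leq_trans kN; rewrite addn1.
(* Here [m] is [N - size al]. At [m = 0] the pair lies in [phi] and [phi']; on shorter words the
   children glue to a pair in [theta] and [theta'] or in [phi] and [phi'], according to parity.
   Either intersection is equality. *)
have LR m al : word N al -> 0 < size al -> size al + m = N -> L' al = R' al.
  elim: m al => [|m IH] al wal al0 alN.
    have [//|h h'] := Htop al wal; first by rewrite addn0 in alN.
    by apply/pI; split; [apply: Drh | apply: Drh'].
  have sal : 0 < size al < N by rewrite al0 -alN -ltn_subLR // subnn.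
  have ch j : 1 <= j <= N -> L' (rcons al j) = R' (rcons al j).
    move=> hj; apply: IH; rewrite ?size_rcons ?addSnnS //.
    by rewrite /word all_rcons hj.
  have ch1 j : 1 <= j <= k -> L' (rcons al j) = R' (rcons al j).
    by case/andP=> h1 h2; apply: ch; rewrite h1 (leq_trans h2).
  have ch2 j : k + 1 <= j <= N -> L' (rcons al j) = R' (rcons al j).
    by case/andP=> h1 h2; apply: ch; rewrite h2 (leq_trans _ h1) // addn1.
  have [od|ev] := boolP (odd (size al)).
    have [l1 l2] := Hodd al wal sal od; apply/tI; split.
      by apply: links_glue (elinks _ _ _ _ _ Dsg l1) ch1; rewrite ?k0.
    by apply: links_glue (elinks _ _ _ _ _ Dsg' l2) ch2; rewrite ?kN ?addn1.
  have [l1 l2] := Heven al wal sal ev; apply/pI; split.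
    by apply: links_glue (elinks _ _ _ _ _ Drh l1) ch1; rewrite ?k0.
  by apply: links_glue (elinks _ _ _ _ _ Drh' l2) ch2; rewrite ?kN ?addn1.
have -> : a = L' [::] by rewrite /L' /= -(Hx A VA w).
have -> : b = R' [::] by rewrite /R' /= (Hy A VA w).
apply: links_glue (elinks _ _ _ _ _ Drh Hroot) _ => [|j hj].
  by rewrite /= muln_gt0.
by apply: (LR N.-1); rewrite /word /= ?andbT // add1n prednK // muln_gt0.
Qed.

(** * Quotient algebras *)

Section Quotient.
Variables (S : signature) (A : algebra S) (D : A -> A -> Prop).
Hypothesis cD : congruence D.

(** A class is a predicate [D a], so that equivalent elements have equal classes by
    extensionality. *)
Definition quotient : Type := {P : A -> Prop | exists a, P = D a}.

Definition class_of (a : A) : quotient :=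
  exist _ (D a) (ex_intro _ a erefl).

Definition repr (q : quotient) : A := sval (cid (svalP q)).

Lemma reprK q : class_of (repr q) = q.
Proof.
rewrite /repr; case: cid => a /=; case: q => P PE /= DE; subst P.
by congr exist; apply: Prop_irrelevance.
Qed.

Lemma class_ofE a b : class_of a = class_of b <-> D a b.
Proof.
have [eqD _] := cD; split => [[->]|Dab]; first reflexivity.
apply: eq_exist => /=; apply: funext => c; apply: propext; split=> h.
  by transitivity a => //; symmetry.
by transitivity b.
Qed.

Lemma repr_class_of a : D (repr (class_of a)) a.
Proof. by apply/class_ofE; rewrite reprK. Qed.

Definition quotient_algebra : algebra S :=
  Algebra (fun (f : op S) qs => class_of (interp (fun i => repr (qs i)))).

Lemma eval_class_of (X : Type) (v : X -> A) (p : term S X) :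
  eval (A := quotient_algebra) (fun x => class_of (v x)) p = class_of (eval v p).
Proof.
elim: p => // f ps IH /=; apply/class_ofE; have [_] := cD; apply=> i.
by rewrite IH; apply: repr_class_of.
Qed.

Definition quotient_rel (theta : A -> A -> Prop) (q r : quotient_algebra) :=
  theta (repr q) (repr r).

Lemma quotient_relE (theta : A -> A -> Prop) a b :
  Equivalence theta -> (forall a b, D a b -> theta a b) ->
  quotient_rel theta (class_of a) (class_of b) <-> theta a b.
Proof.
move=> eqt Dt; have Da := Dt _ _ (repr_class_of a).
have Db := Dt _ _ (repr_class_of b); split=> h.
  by rewrite -Da -Db.
by rewrite /quotient_rel Da Db.
Qed.

Lemma quotient_rel_congruence (theta : A -> A -> Prop) :
  congruence theta -> (forall a b, D a b -> theta a b) ->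
  congruence (quotient_rel theta).
Proof.
move=> [eqt tS] Dt; split.
  split=> [q|q r|q r u]; rewrite /quotient_rel; first reflexivity.
    by symmetry.
  by move=> h1 h2; transitivity (repr r).
by move=> f a b tab; apply/quotient_relE => //; apply: tS.
Qed.

(** Since [D] is exactly the intersection, the induced relations meet in equality; the composition
    property passes to classes. *)
Lemma quotient_complementary (theta theta' : A -> A -> Prop) :
  Equivalence theta -> Equivalence theta' ->
  (forall a b, D a b <-> theta a b /\ theta' a b) ->
  (forall a b, exists c, theta a c /\ theta' c b) ->
  complementary_factors (quotient_rel theta) (quotient_rel theta').
Proof.
move=> eqt eqt' DE tC; split=> q r.
  have := class_ofE (repr q) (repr r); rewrite !reprK => qr.
  exact: iff_trans (iff_sym (DE _ _)) (iff_sym qr).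
have [c [h h']] := tC (repr q) (repr r); exists (class_of c).
rewrite -(reprK q) -(reprK r); split; apply/quotient_relE => //.
  by move=> a b /DE[].
by move=> a b /DE[].
Qed.

End Quotient.

(** Representatives lift an assignment in the quotient to a substitution, and substitution instances
    of the identities of [V] again hold in [V], hence lie in [D]. *)
Lemma variety_quotient (S : signature) (V : algebra S -> Prop) (X : Type)
    (D : term_algebra S X -> term_algebra S X -> Prop) :
  variety V -> inhabited X -> congruence D ->
  (forall p q, identity V p q -> D p q) ->
  V (quotient_algebra D).
Proof.
move=> [E VE] [x] cD ED; apply/VE; split.
  exact: (inhabits (class_of D (Var x))).
move=> p q Epq v.
have -> : v = fun i => class_of D (repr (v i)).
  by apply: funext => i; rewrite reprK.
rewrite !(eval_class_of cD); apply/(class_ofE cD)/ED => A VA w.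
rewrite !eval_subst; by have [_] := (VE A).1 VA; apply.
Qed.

(** * Alternating chains of two relations *)

Section Chain.
Variables (T : Type).
Implicit Types (tau E : T -> T -> Prop).

(** This is the composite of [k + 1] steps in [tau] with [k] steps in [E] between them. *)
Fixpoint chain tau E (k : nat) (p q : T) : Prop :=
  match k with
  | 0 => tau p q
  | k'.+1 => exists a b, [/\ tau p a, E a b & chain tau E k' b q]
  end.

Lemma chain_mono tau E E' k p q :
  (forall a b, E a b -> E' a b) -> chain tau E k p q -> chain tau E' k p q.
Proof.
move=> EE'; elim: k p => //= k IH p [a [b [pa ab bq]]].
by exists a, b; split; [| apply: EE' | apply: IH].
Qed.

Variables (tau E : T -> T -> Prop).
Hypothesis eqt : Equivalence tau.

Lemma chain_step k p q r : tau p q -> chain tau E k q r -> chain tau E k p r.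
Proof.
case: k => [|k] pq /=; first by transitivity q.
by move=> [a [b [qa ab br]]]; exists a, b; split=> //; transitivity q.
Qed.

Lemma chain_cat k k' p q r :
  chain tau E k p q -> chain tau E k' q r -> chain tau E (k + k') p r.
Proof.
elim: k p => [|k IH] p /=; first exact: chain_step.
by move=> [a [b [pa ab bq]]] qr; exists a, b; split=> //; apply: IH.
Qed.

Lemma chain_sym k p q :
  (forall a b, E a b -> E b a) -> chain tau E k p q -> chain tau E k q p.
Proof.
move=> Es; elim: k p => /= [|k IH] p; first by symmetry.
move=> [a [b [pa ab /IH bq]]]; have := chain_cat (k' := 1) bq; rewrite addn1; apply.
by exists b, a; split; [reflexivity | apply: Es | symmetry].
Qed.

(** Reflexive steps of [E] fill the missing length; this brings chains to a common [k]. *)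
Lemma chain_pad k k' p q :
  (forall a, E a a) -> k <= k' -> chain tau E k p q -> chain tau E k' p q.
Proof.
move=> Er kk' pq; rewrite -(subnKC kk'); apply: chain_cat pq _.
elim: (k' - k) => /= [|m IH]; first reflexivity.
by exists q, q; split; [reflexivity | apply: Er |].
Qed.

(** The offset [o] lets two chains occupy consecutive ranges of child indices. *)
Lemma chain_path k p q o :
  chain tau E k.+1 p q ->
  exists a b : nat -> T,
    [/\ tau p (a o), forall j, o <= j <= o + k -> E (a j) (b j),
        forall j, o <= j < o + k -> tau (b j) (a j.+1) & tau (b (o + k)) q].
Proof.
elim: k p o => [|k IH] p o /=.
  move=> [a [b [pa ab bq]]]; exists (fun=> a), (fun=> b); rewrite addn0.
  by split=> // j; rewrite ltnNge andbN.
move=> [a [b [pa ab]]] /(IH _ o.+1)[a' [b' [h1 h2 h3 h4]]].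
exists (fun j => if j == o then a else a' j), (fun j => if j == o then b else b' j).
split=> [|j|j|]; rewrite ?eqxx //.
- move=> /andP[oj jk]; case: eqP => // /eqP jo; apply: h2.
  by rewrite ltn_neqAle eq_sym jo oj addSnnS.
- move=> /andP[oj jk]; rewrite (@gtn_eqF o j.+1) ?ltnS //; case: eqP => [->//|/eqP jo].
  by apply: h3; rewrite ltn_neqAle eq_sym jo oj addSnnS.
- by rewrite gtn_eqF ?addnS ?ltnS ?leq_addr // -addSn.
Qed.

End Chain.

Lemma chain_interp (S : signature) (A : algebra S) (tau E : A -> A -> Prop)
    (k : nat) (f : op S) (a b : 'I_(arity f) -> A) :
  congruence tau ->
  (forall (a b : 'I_(arity f) -> A),
     (forall i, E (a i) (b i)) -> E (interp a) (interp b)) ->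
  (forall i, chain tau E k (a i) (b i)) -> chain tau E k (interp a) (interp b).
Proof.
move=> [eqt tS] ES; elim: k a => [|k IH] a /= ab; first exact: tS.
have [c hc] := choice ab; have [d hd] := choice hc.
exists (interp c), (interp d); split.
- by apply: tS => i; have [] := hd i.
- by apply: ES => i; have [] := hd i.
- by apply: IH => i; have [] := hd i.
Qed.

(* [WW true p q] and [WW false p q] name an element joining the terms p and q
   for the pairs of congruences sigma, sigma^* and rho, rho^* respectively. *)
Inductive wvar (S : signature) (l : nat) : Type :=
| WX
| WY
| WZ of 'I_l
| WW of bool & term S (wvar S l) & term S (wvar S l).

Arguments WX {S l}.
Arguments WY {S l}.
Arguments WZ {S l} _.
Arguments WW {S l} _ _ _.

(** Witness variables are nested inside terms, so the recursion passes through the variables of [p]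
    and [q]. *)
Lemma wvar_term_ind (S : signature) (l : nat) (P : wvar S l -> Prop) :
  P WX -> P WY -> (forall i, P (WZ i)) ->
  (forall b p q, (forall u, occurs u p -> P u) -> (forall u, occurs u q -> P u) ->
     P (WW b p q)) ->
  forall u, P u.
Proof.
move=> hX hY hZ hW; fix F 1 => -[||i|b p q].
- exact: hX.
- exact: hY.
- exact: hZ.
apply: hW; [elim: p => [v u <-|f ps IH u [i]] | elim: q => [v u <-|f ps IH u [i]]].
- exact: F.
- exact: IH.
- exact: F.
- exact: IH.
Qed.

(** * Congruences on the term algebra with witnesses *)

Section Free.
Variables (S : signature) (V : algebra S -> Prop) (l : nat).
Variables (zero one : 'I_l -> term S void).

Local Notation T := (term_algebra S (wvar S l)).

(* The Boolean [b] tells sigma ([true]) from rho ([false]), [st] marks the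
   starred variants. *)
Definition solution (b st : bool) (A : algebra S) (v : wvar S l -> A) : Prop :=
  [/\ forall i, v (WZ i) = eval_closed A ((if st then one else zero) i),
      forall p q, v (WW b p q) = eval v (if st then q else p) &
      b && ~~ st -> v WX = v WY].

(** For a variety [V], a semantic form of the congruence generated by the identities of [V] and the
    equations in [solution b st]. *)
Definition cong (b st : bool) (p q : T) : Prop :=
  forall A : algebra S, V A -> forall v : wvar S l -> A, solution b st v ->
    eval v p = eval v q.

(* Height [m] corresponds to words of length [2 * k - m], of the same parity. *)
Fixpoint rel (k m : nat) (p q : T) : Prop :=
  match m with
  | 0 => cong false false p q /\ cong false true p q
  | m'.+1 => chain (cong (odd m) false) (rel k m') k p q /\
             chain (cong (odd m) true) (rel k m') k p q
  end.

(* For [b] and [st] fixed this is the join of [cong b st] and [total_rel]. *)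
Definition join_rel (b st : bool) (p q : T) : Prop :=
  exists k m, 0 < k /\ chain (cong b st) (rel k m) k p q.

(** The congruence D of the necessity argument, as a union of stages. For positive [k] the stages
    increase in [k] and [m]. *)
Definition total_rel (p q : T) : Prop := exists k m, 0 < k /\ rel k m p q.

Lemma cong_congruence b st : congruence (cong b st).
Proof.
split; first split=> [p|p q|p q r] //.
- by move=> pq A VA v sv; rewrite (pq A VA v sv).
- by move=> pq qr A VA v sv; rewrite (pq A VA v sv) (qr A VA v sv).
move=> f ps qs pq A VA v sv /=.
have /funext -> // : forall i, eval v (ps i) = eval v (qs i).
by move=> i; apply: pq.
Qed.

Lemma cong_equivalence b st : Equivalence (cong b st).
Proof. by have [] := cong_congruence b st. Qed.

#[local] Existing Instance cong_equivalence.
#[local] Hint Resolve cong_equivalence : core.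

Lemma rel_refl k m p : rel k m p p.
Proof.
elim: m p => [|m IH] p; first by [].
have H st : chain (cong (odd m.+1) st) (rel k m) k p p by exact: (@chain_pad _ _ _ _ 0).
by split; apply: H.
Qed.

Lemma rel_sym k m p q : rel k m p q -> rel k m q p.
Proof.
elim: m p q => [|m IH] p q [h1 h2]; first by split; symmetry.
by split; apply: chain_sym.
Qed.

Lemma rel_interp k m (f : op S) (a b : 'I_(arity f) -> T) :
  (forall i, rel k m (a i) (b i)) -> rel k m (interp a) (interp b).
Proof.
elim: m a b => [|m IH] a b ab.
  by split; have [_] := cong_congruence false false;
    have [_ h] := cong_congruence false true; move=> h'; [apply: h'|apply: h] => i;
    have [] := ab i.
by split; apply: chain_interp => //; try exact: cong_congruence; move=> i;
  have [] := ab i.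
Qed.

Lemma rel_succ k m p q : 0 < k -> rel k m p q -> rel k m.+1 p q.
Proof.
move=> k0 pq; have H st : chain (cong (odd m.+1) st) (rel k m) k p q.
  apply: (@chain_pad _ _ _ _ 1) => //; first exact: rel_refl.
  by exists p, q; split=> //; reflexivity.
by split; apply: H.
Qed.

Lemma rel_mono k k' m m' p q :
  0 < k <= k' -> m <= m' -> rel k m p q -> rel k' m' p q.
Proof.
move=> /andP[k0 kk'] mm'.
have H1 : rel k m p q -> rel k' m p q.
  elim: m p q {mm'} => // m IH p q [h1 h2].
  by split; apply: (@chain_pad _ _ _ _ k) => //; try exact: rel_refl;
    apply: chain_mono IH _.
move/H1; rewrite -(subnKC mm'); elim: (m' - m) => [|d IH] pq; first by rewrite addn0.
by rewrite addnS; apply: rel_succ; [exact: leq_trans kk' | apply: IH].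
Qed.

Lemma chain_rel_mono b st k k' m m' p q :
  0 < k <= k' -> m <= m' -> chain (cong b st) (rel k m) k p q ->
  chain (cong b st) (rel k' m') k' p q.
Proof.
move=> kk' mm' pq; apply: (@chain_pad _ _ _ _ k) => //; first exact: rel_refl.
  by case/andP: kk'.
by apply: chain_mono pq => a c; apply: rel_mono.
Qed.

Lemma join_rel_congruence b st : congruence (join_rel b st).
Proof.
split; first split=> [p|p q|p q r].
- by exists 1, 0; split=> //; apply: (@chain_pad _ _ _ _ 0) => //; exact: rel_refl.
- move=> [k [m [k0 pq]]]; exists k, m; split=> //.
  by apply: chain_sym => //; apply: rel_sym.
- move=> [k [m [k0 pq]]] [k' [m' [k'0 qr]]].
  exists (k + k'), (m + m'); split; first by rewrite addn_gt0 k0.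
  apply: (@chain_cat _ _ _ _ k k' p q r) => //.
    by apply: chain_mono pq => a c; apply: rel_mono; rewrite ?k0 leq_addr.
  by apply: chain_mono qr => a c; apply: rel_mono; rewrite ?k'0 leq_addl.
move=> f a c ac; have [K hK] := choice ac; have [M hM] := choice hK.
(* Arities are finite, so the bounds for the arguments have maxima; the successor keeps the width
   positive when [f] is a constant. *)
exists (\max_i K i).+1, (\max_i M i); split=> //.
apply: chain_interp => //; try exact: cong_congruence; first exact: rel_interp.
move=> i; have [Ki] := hM i; apply: chain_rel_mono; last exact: leq_bigmax.
by rewrite Ki ltnW // ltnS leq_bigmax.
Qed.

(** Two chains over stages of different sizes fit into one larger stage, whose height may be given
    either parity. *)
Lemma total_relE b p q :
  total_rel p q <-> join_rel b false p q /\ join_rel b true p q.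
Proof.
split=> [[k [m [k0 pq]]]|[[k [m [k0 pq]]] [k' [m' [k'0 pq']]]]].
  have H st : join_rel b st p q.
    exists k, m; split=> //; apply: (@chain_pad _ _ _ _ 1) => //.
      exact: rel_refl.
    by exists p, q; split=> //; reflexivity.
  by split; apply: H.
(* [M] is at least [m + m'], and its parity makes height [M.+1] use the pair selected by [b]. *)
pose M := (m + m').*2 + ~~ b.
have oM : odd M.+1 = b by rewrite /= oddD odd_double /=; case: (b).
have leM : m + m' <= M by rewrite /M -addnn -addnA leq_addr.
exists (k + k'), M.+1; split; first by rewrite addn_gt0 k0.
rewrite /rel -/rel oM; split; [move: pq | move: pq']; apply: chain_rel_mono.
- by rewrite k0 leq_addr.
- by apply: leq_trans leM; rewrite leq_addr.
- by rewrite k'0 leq_addl.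
- by apply: leq_trans leM; rewrite leq_addl.
Qed.

Lemma total_rel_join b st p q : total_rel p q -> join_rel b st p q.
Proof. by move=> /(total_relE b)[]; case: st. Qed.

Lemma total_rel_congruence : congruence total_rel.
Proof.
have [[r1 s1 t1] c1] := join_rel_congruence true false.
have [[r2 s2 t2] c2] := join_rel_congruence true true.
split; first split=> [p|p q|p q r].
- by apply/(total_relE true); split.
- by move=> /(total_relE true)[? ?]; apply/(total_relE true); split; auto.
- move=> /(total_relE true)[h1 h2] /(total_relE true)[h3 h4].
  by apply/(total_relE true); split; [apply: t1 h3 | apply: t2 h4].
move=> f a c ac; apply/(total_relE true); split; [apply: c1 | apply: c2] => i.
  by have /(total_relE true)[] := ac i.
by have /(total_relE true)[] := ac i.
Qed.

Lemma cong_join b st p q : cong b st p q -> join_rel b st p q.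
Proof.
by move=> pq; exists 1, 0; split=> //; exists q, q.
Qed.

Lemma identity_total_rel p q : identity V p q -> total_rel p q.
Proof. by move=> pq; exists 1, 0; split=> //; split=> A VA v _; apply: pq. Qed.

(** The witness [WW b p q] is equal to [p] modulo the unstarred congruence and to [q] modulo the
    starred one. *)
Lemma join_rel_comp b (p q : T) :
  exists r, join_rel b false p r /\ join_rel b true r q.
Proof.
exists (Var (WW b p q)).
by split; apply: cong_join => A VA v [_ /(_ p q) hw _] /=.
Qed.

(* In the quotient by [total_rel] the variable tuple z satisfies the hypotheses
   of the Left Determining Property, and sigma identifies x and y. *)
Lemma left_determining_join_rel :
  variety V -> left_determining V zero one ->
  join_rel false false (Var WX) (Var WY).
Proof.
move=> vV ldp.
have cD := total_rel_congruence.
have eqJ b st : Equivalence (join_rel b st) by have [] := join_rel_congruence b st.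
pose J b st := quotient_rel (D := total_rel) (join_rel b st).
have cJ b st : congruence (J b st).
  apply: quotient_rel_congruence => //; first exact: join_rel_congruence.
  by move=> p q; apply: total_rel_join.
have fJ b : complementary_factors (J b false) (J b true).
  apply: quotient_complementary => //; last exact: join_rel_comp.
  exact: total_relE.
have JE b st p q : J b st (class_of _ p) (class_of _ q) <-> join_rel b st p q.
  by apply: quotient_relE => // a c; apply: total_rel_join.
have closedE z : eval_closed (quotient_algebra total_rel) z =
                 class_of total_rel (eval_closed T z).
  rewrite /eval_closed -(eval_class_of cD).
  by apply: eval_occurs => -[].
have VQ : V (quotient_algebra total_rel).
  by apply: variety_quotient => //; [exact: (inhabits WX) | exact: identity_total_rel].
have zJ b i : J b false (eval_closed (quotient_algebra total_rel) (zero i))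
                        (class_of total_rel (Var (WZ i))).
  rewrite closedE; apply/JE/cong_join => A VA v [hz _ _] /=.
  by rewrite hz eval_eval_closed.
have oJ b i : J b true (class_of total_rel (Var (WZ i)))
                       (eval_closed (quotient_algebra total_rel) (one i)).
  rewrite closedE; apply/JE/cong_join => A VA v [hz _ _] /=.
  by rewrite hz eval_eval_closed.
(* Here [phi] comes from sigma and [theta] from rho; the equivalence is read from sigma to rho. *)
apply/JE; apply: (iffRL (ldp _ _ _ _ _ _ VQ (cJ true false) (cJ true true)
  (cJ false false) (cJ false true) (fJ true) (fJ false) (zJ false) (oJ false)
  (zJ true) (oJ true) _ _)).
by apply/JE/cong_join => A VA v [_ _ hxy] /=; apply: hxy.
Qed.

(** * Trees of terms as finite certificates *)

(** The node [alpha] has height [m - size alpha], whose parity selects sigma or rho as in [rel]. *)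
Definition rel_tree (k m : nat) (L R : seq nat -> T) : Prop :=
  (forall alpha, word (2 * k) alpha -> size alpha = m ->
     cong false false (L alpha) (R alpha) /\ cong false true (L alpha) (R alpha)) /\
  (forall alpha, word (2 * k) alpha -> size alpha < m ->
     let b := odd (m - size alpha) in
     links (cong b false) L R alpha 1 k /\
     links (cong b true) L R alpha (k + 1) (2 * k)).

(** Subtrees for all children are put under a new root. Their existence is a hypothesis, so as to
    serve both the inductive step for [rel_tree] and the root. *)
Lemma rel_tree_graft k m p q (a b : nat -> T) :
  (forall p q, rel k m p q ->
     exists L R, [/\ L [::] = p, R [::] = q & rel_tree k m L R]) ->
  (forall j, 1 <= j <= 2 * k -> rel k m (a j) (b j)) ->
  exists L R,
    [/\ L [::] = p, R [::] = q,
        forall j, 1 <= j <= 2 * k -> L [:: j] = a j /\ R [:: j] = b j &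
        forall j, 1 <= j <= 2 * k ->
          rel_tree k m (fun alpha => L (j :: alpha)) (fun alpha => R (j :: alpha))].
Proof.
move=> tree ab.
have /choice[F hF] j : exists LR : (seq nat -> T) * (seq nat -> T),
    1 <= j <= 2 * k ->
    [/\ LR.1 [::] = a j, LR.2 [::] = b j & rel_tree k m LR.1 LR.2].
  have [/ab/tree[L [R h]]|_] := boolP (1 <= j <= 2 * k).
    by exists (L, R).
  (* Outside the alphabet any value will do. *)
  by exists (fun=> p, fun=> p).
exists (fun al => if al is j :: al' then (F j).1 al' else p).
exists (fun al => if al is j :: al' then (F j).2 al' else q).
by split=> // j /hF[].
Qed.

(** The unstarred chain supplies the children [1..k] and the starred one the children [k + 1..2k],
    each at height one less. *)
Lemma exists_rel_tree k m p q :
  0 < k -> rel k m p q -> exists L R, [/\ L [::] = p, R [::] = q & rel_tree k m L R].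
Proof.
case: k => // k _; elim: m p q => [|m IH] p q /=.
  move=> pq; exists (fun=> p), (fun=> q); split=> //; split=> //.
move=> [/(chain_path 1)[a1 [b1 [pa1 ab1 ba1 bq1]]]].
move=> /(chain_path (k.+1 + 1))[a2 [b2 [pa2 ab2 ba2 bq2]]].
have k2E : k.+1 + 1 + k = 2 * k.+1 by rewrite addn1 mul2n -addnn !addSn addnS.
have [||L [R [Lp Rq LRj LRt]]] := @rel_tree_graft k.+1 m p q
  (fun j => if j <= k.+1 then a1 j else a2 j)
  (fun j => if j <= k.+1 then b1 j else b2 j).
- exact: IH.
- move=> j /andP[j1 jN]; case: leqP => jk; first by apply: ab1; rewrite j1.
  by apply: ab2; rewrite k2E addn1 jk.
exists L, R; split=> //; split=> [[|j al]|[|j al]] //=.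
- by case/andP=> hj wal [sal]; have [h _] := LRt j hj; apply: h.
- move=> _ _; have kN : k.+1 < 2 * k.+1 by rewrite -k2E addn1 addSn ltnS leq_addr.
  split; split=> [|j /andP[lo hi]|].
  + by have [-> _] := LRj 1 isT; rewrite Lp.
  + have jk : j < k.+1 by rewrite subn1 in hi.
    have [|_ ->] := LRj j; first by rewrite lo ltnW ?(ltn_trans jk kN).
    have [|-> _] := LRj (j + 1).
      by rewrite addn1; apply: ltn_trans jk kN.
    by rewrite addn1 jk (ltnW jk); apply: ba1; rewrite lo add1n.
  + have [|_ ->] := LRj k.+1; first exact: (ltnW kN).
    by rewrite leqnn Rq -add1n.
  + have [|-> _] := LRj (k.+1 + 1); first by rewrite -k2E leq_addr addn1.
    by rewrite addn1 ltnn Lp -addn1.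
  + have jN : j < 2 * k.+1 by rewrite subn1 -ltnS prednK // muln_gt0 in hi.
    have jk : k.+1 < j by rewrite addn1 in lo.
    have [|_ ->] := LRj j; first by rewrite (leq_trans _ jk) // ltnW.
    have [|-> _] := LRj (j + 1); first by rewrite addn1.
    rewrite addn1 leqNgt jk /= leqNgt (ltn_trans jk) //=.
    by apply: ba2; rewrite lo k2E.
  + have [|_ ->] := LRj (2 * k.+1); first by rewrite leqnn muln_gt0.
    by move: bq2; rewrite k2E leqNgt kN Rq.
- by move=> /andP[hj wal] sal; have [_ h] := LRt j hj; apply: h.
Qed.

(** The root carries a single rho-chain through all [2 * k] children, while every other inner node
    carries two chains of half that length. *)
Lemma exists_root_tree :
  join_rel false false (Var WX) (Var WY) ->
  exists k, 0 < k /\ exists L R,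
    [/\ L [::] = Var WX, R [::] = Var WY,
        links (cong false false) L R [::] 1 (2 * k) &
        forall j, 1 <= j <= 2 * k -> rel_tree k (2 * k).-1
          (fun alpha => L (j :: alpha)) (fun alpha => R (j :: alpha))].
Proof.
(* One number must bound both width and height: [k0 <= k] lets the chain be padded, and
   [m <= 2 * k - 1] fits the height of the subtrees. *)
move=> [k0 [m [k00 xy]]]; pose k := (k0 + m).+1; exists k; split=> //.
have NE : (2 * k).-1.+1 = 2 * k by rewrite prednK // muln_gt0.
have mN : m <= (2 * k).-1.
  by rewrite -ltnS NE mul2n -addnn /k addSn ltnS -addnS -!addnA addnCA leq_addr.
have : chain (cong false false) (rel k (2 * k).-1) (2 * k).-1.+1 (Var WX) (Var WY).
  apply: (@chain_pad _ _ _ _ k) => //; first exact: rel_refl.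
    by rewrite NE mul2n -addnn leq_addr.
  apply: chain_rel_mono xy => //.
  by rewrite k00 /k ltnW // ltnS leq_addr.
move=> /(chain_path 1)[a [b [pa ab ba bq]]].
have [||L [R [Lp Rq LRj LRt]]] :=
    @rel_tree_graft k (2 * k).-1 (Var WX) (Var WY) a b.
- by move=> p q; apply: exists_rel_tree.
- by move=> j hj; apply: ab; rewrite add1n NE.
exists L, R; split=> //; split=> [|j /andP[lo hi]|] /=.
- by have [-> _] := LRj 1 isT; rewrite Lp.
- have jN : j < 2 * k by rewrite subn1 -ltnS NE in hi.
  have [|_ ->] := LRj j; first by rewrite lo ltnW.
  have [|-> _] := LRj (j + 1); first by rewrite addn1.
  by rewrite addn1; apply: ba; rewrite lo add1n NE.
- have [|_ ->] := LRj (2 * k); first by rewrite leqnn muln_gt0.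
  by rewrite Rq -{1}NE -add1n.
Qed.

End Free.

(** Classical equality on terms, so that pairs of terms can be looked up in sequences. *)
HB.instance Definition _ (S : signature) (X : Type) := gen_eqMixin (term S X).

(** * Renaming finitely many witnesses to x_j and y_j *)

Section Renaming.
Variables (S : signature) (l : nat).

Local Notation G := (term S (wvar S l)).
Implicit Types (r : seq (G * G)) (u : wvar S l) (p q : G).

(** One pair serves both kinds of witness: its position [j] provides x_j for [true] and y_j for
    [false]. *)
Definition covered r u : bool := if u is WW _ p q then (p, q) \in r else true.

Definition supports r p : Prop := forall u, occurs u p -> covered r u.

(** First positions are compared, so repetitions in [r] do no harm. The inequality also forces
    [(p', q')] into [r], since an absent pair has index [size r]. *)
Definition ordered r : Prop :=
  forall p q u, (p, q) \in r -> occurs u p \/ occurs u q ->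
    if u is WW _ p' q' then index (p', q') r < index (p, q) r else true.

Lemma covered_sub r r' u : {subset r <= r'} -> covered r u -> covered r' u.
Proof. by move=> rr'; case: u => //= _ p q; apply: rr'. Qed.

Lemma supports_sub r r' p : {subset r <= r'} -> supports r p -> supports r' p.
Proof. by move=> rr' rp u /rp; apply: covered_sub. Qed.

Lemma ordered_cat r r' : ordered r -> ordered r' -> ordered (r ++ r').
Proof.
move=> or or' p q [||//|b p' q'] // pq u.
have ltr : (p, q) \in r -> index (p', q') (r ++ r') < index (p, q) (r ++ r').
  move=> pqr; have lt := or _ _ _ pqr u; rewrite !index_cat pqr ifT //.
  by rewrite -index_mem (ltn_trans lt) // index_mem.
have [/ltr//|npq] := boolP ((p, q) \in r).
have pqr' : (p, q) \in r' by rewrite mem_cat (negPf npq) in pq.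
have lt := or' _ _ _ pqr' u; rewrite !index_cat (negPf npq).
case: ifP => h; last by rewrite ltn_add2l.
by rewrite ltn_addr // index_mem.
Qed.

Lemma ordered_rcons r p q :
  ordered r -> supports r p -> supports r q -> ordered (rcons r (p, q)).
Proof.
move=> or rp rq p0 q0 [||//|b p' q'] // pq u; rewrite -cats1 !index_cat.
have [pqr|npq] := boolP ((p0, q0) \in r).
  have lt := or _ _ _ pqr u; rewrite ifT //.
  by rewrite -index_mem (ltn_trans lt) // index_mem.
have [ep eq] : p0 = p /\ q0 = q.
  by move: pq; rewrite mem_rcons inE (negPf npq) orbF => /eqP[].
have h : (p', q') \in r.
  by case: u; rewrite ?ep ?eq; [move/rp | move/rq].
by rewrite h ltn_addr // index_mem.
Qed.

(** Ordered lists can be concatenated, so finitely many requirements that survive enlargement are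
    met at once. *)
Lemma exists_ordered_forall (I : finType) (P : I -> seq (G * G) -> Prop) :
  (forall i r r', {subset r <= r'} -> P i r -> P i r') ->
  (forall i, exists r, ordered r /\ P i r) ->
  exists r, ordered r /\ forall i, P i r.
Proof.
move=> Psub /choice[F hF]; exists (flatten [seq F i | i <- enum I]); split.
  elim: (enum I) => [|i s IH] //=; apply: ordered_cat => //.
  by have [] := hF i.
move=> i; apply: Psub (proj2 (hF i)) => pq pqi.
by apply/flatten_mapP; exists i; rewrite ?mem_enum.
Qed.

(** By induction on witnesses, with an inner induction on terms: the list for [WW b p q] joins those
    for [p] and [q] and ends with [(p, q)]. *)
Lemma exists_ordered_supports p : exists r, ordered r /\ supports r p.
Proof.
have term_case p0 : (forall u, occurs u p0 -> exists r, ordered r /\ covered r u) ->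
    exists r, ordered r /\ supports r p0.
  elim: p0 => [u|f ps IH] hu.
    have [r [or ru]] := hu u erefl; exists r; split=> // u' /= <- //.
  have [||r [or rP]] := @exists_ordered_forall 'I_(arity f)
    (fun i r => supports r (ps i)).
  - by move=> i r r'; apply: supports_sub.
  - by move=> i; apply: IH => u ui; apply: hu; exists i.
  by exists r; split=> // u [i] /rP.
apply: (term_case) => u _; elim/wvar_term_ind: u => [||i|b p' q' IHp IHq].
- by exists [::].
- by exists [::].
- by exists [::].
have [r [or rp]] := term_case _ IHp; have [r' [or' rq]] := term_case _ IHq.
exists (rcons (r ++ r') (p', q')); split; last by rewrite /= mem_rcons inE eqxx.
apply: ordered_rcons; first exact: ordered_cat.
  by apply: supports_sub rp => x xr; rewrite mem_cat xr.
by apply: supports_sub rq => x xr; rewrite mem_cat xr orbT.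
Qed.

Lemma exists_ordered_words N m (L : seq nat -> G) :
  exists r, ordered r /\
    forall alpha, word N alpha -> size alpha <= m -> supports r (L alpha).
Proof.
elim: m L => [|m IH] L.
  have [r [or rp]] := exists_ordered_supports (L [::]).
  by exists r; split=> // -[].
(* [None] stands for the empty word and [Some j] for the words that begin with [j]. *)
have [||r [or rP]] := @exists_ordered_forall (option 'I_N.+1) (fun o r =>
  if o is Some j then forall alpha, word N alpha -> size alpha <= m ->
                        supports r (L (nat_of_ord j :: alpha))
  else supports r (L [::])).
- move=> [j|] r r' rr'; last exact: supports_sub.
  by move=> h al wal sal; apply: supports_sub rr' _; apply: h.
- move=> [j|]; last exact: exists_ordered_supports.
  exact: (IH (fun alpha => L (nat_of_ord j :: alpha))).
exists r; split=> // -[|j al]; first by move=> _ _; apply: (rP None).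
move=> /andP[/andP[_ jN] wal] sal.
exact: (rP (Some (Ordinal (jN : j < N.+1)))).
Qed.

(** The bound [n] is [size r] for whole tuples and [j] inside the terms s_j and t_j, which see only
    earlier variables. [VX] is a default for pairs out of range. *)
Definition rename r n u : xvar l n :=
  match u with
  | WX => VX
  | WY => VY
  | WZ i => VZ i
  | WW b p q =>
      if insub (index (p, q) r) is Some j then (if b then VXs j else VYs j) else VX
  end.

Definition rename_term r n p : term S (xvar l n) :=
  subst (fun u => Var (rename r n u)) p.

(** The projection [fst] yields the terms s_j, and [snd] yields the t_j. *)
Definition renamed_family r (f : G * G -> G) : term_family S l (size r) :=
  fun j => rename_term r j (f (nth (Var WX, Var WX) r j)).

Arguments renamed_family r f : clear implicits.

Lemma eval_rename_term (A : algebra S) r n (v : xvar l n -> A) p :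
  eval v (rename_term r n p) = eval (fun u => v (rename r n u)) p.
Proof. exact: eval_subst. Qed.

(** A solution must satisfy the equations of all witnesses of kind [b], also of those outside [r];
    hence their values are recomputed recursively and only the rest is taken from [g]. *)
Fixpoint solution_of (A : algebra S) (b st : bool) (g : wvar S l -> A) u : A :=
  match u with
  | WW c p q =>
      if c == b then
        if st then eval (solution_of b st g) q else eval (solution_of b st g) p
      else g u
  | _ => g u
  end.

Lemma solution_of_WW (A : algebra S) (b st : bool) (g : wvar S l -> A) p q :
  solution_of b st g (WW b p q) =
  eval (solution_of b st g) (if st then q else p).
Proof. by rewrite /= eqxx; case: st. Qed.

Variables (zero one : 'I_l -> term S void) (r : seq (G * G)).
Hypothesis or : ordered r.

(** The agreement is by induction on witnesses: the solved entry at the position of [(p, q)] is the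
    value of the renamed [p] or [q], whose witnesses come earlier in [r]. *)
Lemma solution_of_rename (A : algebra S) (b st : bool)
    (v : xvar l (size r) -> A) :
  let v' := solve b (b && ~~ st) (if st then one else zero)
              (renamed_family r (if st then snd else fst)) v in
  let w := solution_of b st (fun u => v' (rename r (size r) u)) in
  solution zero one b st w /\
  forall u, covered r u -> w u = v' (rename r (size r) u).
Proof.
set f : G * G -> G := if st then _ else _; move=> v' w.
have [hX hY hZ] := extend_start b (v VX) (if b && ~~ st then v VX else v VY)
  (fun i => eval_closed A ((if st then one else zero) i)) (renamed_family r f)
  (fun j => v (if b then VYs j else VXs j)).
have hs := extend_solved b (v VX) (if b && ~~ st then v VX else v VY)
  (fun i => eval_closed A ((if st then one else zero) i)) (renamed_family r f)
  (fun j => v (if b then VYs j else VXs j)).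
split.
  split=> [i|p q|h] /=.
  - exact: hZ.
  - exact: solution_of_WW.
  - by rewrite /w /= /v' /solve hX hY h.
elim/wvar_term_ind => // c p q IHp IHq cov.
have [cb|cb] := boolP (c == b); last by rewrite {1}/w /= (negPf cb).
rewrite (eqP cb) in cov *; rewrite {1}/w solution_of_WW -/w.
have jn : index (p, q) r < size r by rewrite index_mem.
rewrite /rename insubT; have := hs (Ordinal jn).
rewrite -/(solve _ _ _ _ v) -/v' => hs'.
have -> : (if st then q else p) = f (p, q) by rewrite /f; case: (st).
transitivity (v' (if b then VXs (Ordinal jn) else VYs (Ordinal jn))); last first.
  by case: (b).
rewrite hs' /renamed_family eval_rename_term nth_index //.
apply: eval_occurs => u uf.
have u_pq : occurs u p \/ occurs u q.
  by move: uf; rewrite /f; case: (st) => /=; [right | left].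
have lt := or cov u_pq.
have -> : w u = v' (rename r (size r) u).
  have cu : covered r u.
    by case: u lt {uf u_pq} => //= _ p' q' lt; rewrite -index_mem (ltn_trans lt).
  by case: u_pq => [/IHp|/IHq]; apply.
(* The position of [(p', q')] lies below both bounds [index (p, q) r] and [size r], so renaming
   under either gives the same variable. *)
case: u lt {uf u_pq} => //= c' p' q' lt.
rewrite !insubT ?(ltn_trans lt) //= => lt'.
by case: (c'); congr (v' (_ _)); apply/val_inj.
Qed.

(** A solved tuple, read through [rename], agrees on the variables of [p] and [q] with a solution,
    where the hypothesis applies. *)
Lemma cong_identity (V : algebra S -> Prop) (b st : bool) p q :
  cong V zero one b st p q -> supports r p -> supports r q ->
  let slv := subst (solve (A := term_algebra S _) b (b && ~~ st)
    (if st then one else zero) (renamed_family r (if st then snd else fst)) Var) in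
  identity V (slv (rename_term r _ p)) (slv (rename_term r _ q)).
Proof.
move=> pq rp rq slv A VA v; rewrite !eval_solve !eval_rename_term.
have [sw wE] := solution_of_rename b st v; set w := solution_of _ _ _ in sw wE.
rewrite -(@eval_occurs _ _ A w _ p); last by move=> u /rp/wE.
rewrite -(@eval_occurs _ _ A w _ q); last by move=> u /rq/wE.
exact: pq.
Qed.

End Renaming.

Arguments renamed_family {S l} r f _.

(** In use, [P] says that the list of witness pairs supports the term, as the transfer to identities
    requires. *)
Lemma links_impl (T T' : Type) (tau : T -> T -> Prop) (tau' : T' -> T' -> Prop)
    (f : T -> T') (P : T -> Prop) (L R : seq nat -> T) (alpha : seq nat)
    (lo hi : nat) :
  (forall p q, tau p q -> P p -> P q -> tau' (f p) (f q)) -> 0 < lo <= hi ->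
  P (L alpha) -> P (R alpha) ->
  (forall j, lo <= j <= hi -> P (L (rcons alpha j)) /\ P (R (rcons alpha j))) ->
  links tau L R alpha lo hi -> links tau' (f \o L) (f \o R) alpha lo hi.
Proof.
move=> tt' /andP[lo0 lohi] PL PR Pj [h1 h2 h3].
have hi0 : 0 < hi := leq_trans lo0 lohi.
split=> [|j /andP[loj jhi]|] /=.
- by apply: tt' => //; have [] := Pj lo; rewrite ?leqnn.
- have jh : j < hi by rewrite -(prednK hi0) ltnS -subn1.
  apply: tt'; first by apply: h2; rewrite loj.
    by have [] := Pj j; rewrite ?loj ?(ltnW jh).
  by have [] := Pj (j + 1); rewrite ?addn1 ?jh ?andbT ?(leq_trans loj).
- by apply: tt' => //; have [] := Pj hi; rewrite ?lohi ?leqnn.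
Qed.

Theorem theorem6 (S : signature) (V : algebra S -> Prop) (l : nat)
    (zero one : 'I_l -> term S void) (HV : variety_with_01 V zero one) :
  left_determining V zero one <->
  exists (k n : nat), 0 < k /\ 0 < n /\
  exists (s t : term_family S l n) (L R : seq nat -> term S (xvar l n)),
    let N := 2 * k in
    let T := term_algebra S (xvar l n) in
    let X : xvar l n -> T := Var in
    let at_sigma := subst (sigma (A := T) zero s X) in
    let at_sigma' := subst (sigma_star (A := T) one t X) in
    let at_rho := subst (rho (A := T) zero s X) in
    let at_rho' := subst (rho_star (A := T) one t X) in
    (* The families L and R are indexed by all words; only the terms L_alpha
       and R_alpha with |alpha| <= N occur below. *)
    [/\ (* |alpha| = N *)
        forall alpha : seq nat, word N alpha -> size alpha = N ->
          identity V (at_rho (L alpha)) (at_rho (R alpha)) /\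
          identity V (at_rho' (L alpha)) (at_rho' (R alpha)),
        (* |alpha| = 0 *)
        [/\ identity V (Var VX) (L [::]),
            identity V (R [::]) (Var VY),
            identity V (at_rho (L [::])) (at_rho (L [:: 1])),
            forall j, 1 <= j <= N - 1 ->
              identity V (at_rho (R [:: j])) (at_rho (L [:: j + 1])) &
            identity V (at_rho (R [:: N])) (at_rho (R [::]))],
        (* 0 < |alpha| < N, |alpha| even *)
        forall alpha : seq nat, word N alpha ->
          0 < size alpha < N -> ~~ odd (size alpha) ->
          [/\ identity V (at_rho (L alpha)) (at_rho (L (rcons alpha 1))),
              forall j, 1 <= j <= k - 1 ->
                identity V (at_rho (R (rcons alpha j)))
                           (at_rho (L (rcons alpha (j + 1)))) &
              identity V (at_rho (R (rcons alpha k))) (at_rho (R alpha))] /\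
          [/\ identity V (at_rho' (L alpha)) (at_rho' (L (rcons alpha (k + 1)))),
              forall j, k + 1 <= j <= N - 1 ->
                identity V (at_rho' (R (rcons alpha j)))
                           (at_rho' (L (rcons alpha (j + 1)))) &
              identity V (at_rho' (R (rcons alpha N))) (at_rho' (R alpha))] &
        (* 0 < |alpha| < N, |alpha| odd *)
        forall alpha : seq nat, word N alpha ->
          0 < size alpha < N -> odd (size alpha) ->
          [/\ identity V (at_sigma (L alpha)) (at_sigma (L (rcons alpha 1))),
              forall j, 1 <= j <= k - 1 ->
                identity V (at_sigma (R (rcons alpha j)))
                           (at_sigma (L (rcons alpha (j + 1)))) &
              identity V (at_sigma (R (rcons alpha k))) (at_sigma (R alpha))] /\
          [/\ identity V (at_sigma' (L alpha))
                         (at_sigma' (L (rcons alpha (k + 1)))),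
              forall j, k + 1 <= j <= N - 1 ->
                identity V (at_sigma' (R (rcons alpha j)))
                           (at_sigma' (L (rcons alpha (j + 1)))) &
              identity V (at_sigma' (R (rcons alpha N))) (at_sigma' (R alpha))]].
Proof.
split=> [ldp|[k [n [k0 [n0 [s [t [L [R [Htop [Hx Hy H1 H2 H3] Heven Hodd]]]]]]]]]]; last first.
  have incl := left_determining_incl k0 Htop Hx Hy (And3 H1 H2 H3) Heven Hodd.
  move=> A e phi phi' theta theta' VA cp cp' ct ct' fp ft t0 t1 p0 p1 a b.
  by split; [apply: (incl A e phi phi' theta theta') |
             apply: (incl A e theta theta' phi phi')].
have [vV _] := HV.
have [k [k0 [L [R [Lx Ry Hroot Htree]]]]] :=
  exists_root_tree (left_determining_join_rel vV ldp).
pose N := 2 * k.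
have N0 : 0 < N by rewrite muln_gt0.
have NE : N.-1.+1 = N by rewrite prednK.
have [rL [orL suppL]] := exists_ordered_words N N L.
have [rR [orR suppR]] := exists_ordered_words N N R.
(* The additional pair makes [n = size r] positive. *)
pose r := rcons (rL ++ rR) (Var WX, Var WX).
have or : ordered r.
  by apply: ordered_rcons; [exact: ordered_cat | move=> u <- | move=> u <-].
have suppLr al : word N al -> size al <= N -> supports r (L al).
  move=> wal sal; apply: supports_sub (suppL al wal sal) => x xr.
  by rewrite mem_rcons inE mem_cat xr !orbT.
have suppRr al : word N al -> size al <= N -> supports r (R al).
  move=> wal sal; apply: supports_sub (suppR al wal sal) => x xr.
  by rewrite mem_rcons inE mem_cat xr !orbT.
pose ren := rename_term r (size r).
have ci b st := @cong_identity S l zero one r or V b st.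
have ciL b st al lo hi : word N al -> size al < N -> 0 < lo -> lo <= hi <= N ->
    links (cong V zero one b st) L R al lo hi ->
    links (fun p q => identity V
      (subst (solve (A := term_algebra S _) b (b && ~~ st)
        (if st then one else zero) (renamed_family r (if st then snd else fst)) Var) p)
      (subst (solve (A := term_algebra S _) b (b && ~~ st)
        (if st then one else zero) (renamed_family r (if st then snd else fst)) Var) q))
      (ren \o L) (ren \o R) al lo hi.
  move=> wal sal lo0 /andP[lohi hiN]; apply: (links_impl (ci b st)).
  - by rewrite lo0.
  - by apply: suppLr => //; apply: ltnW.
  - by apply: suppRr => //; apply: ltnW.
  move=> j /andP[loj jhi]; have wj : word N (rcons al j).
    by rewrite /word all_rcons (leq_trans lo0 loj) (leq_trans jhi hiN).
  by split; [apply: suppLr | apply: suppRr]; rewrite ?size_rcons.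
have kN : k + 1 <= N by rewrite /N mul2n -addnn leq_add2l.
exists k, (size r); split=> //; split; first by rewrite size_rcons.
exists (renamed_family r fst), (renamed_family r snd), (ren \o L), (ren \o R).
have inner al : word N al -> 0 < size al < N -> let b := odd (size al) in
    links (cong V zero one b false) L R al 1 k /\
    links (cong V zero one b true) L R al (k + 1) N.
  case: al => // j beta /andP[hj wal] /= sal; have [_ h] := Htree j hj.
  have := h beta wal; rewrite -ltnS NE => /(_ sal).
  (* Since [N] is even, the height [N - size al] has the parity of [size al]. *)
  by rewrite -[N.-1 - _]subSS NE oddB ?(ltnW sal) // /N oddM.
have top al : word N al -> size al = N ->
    cong V zero one false false (L al) (R al) /\
    cong V zero one false true (L al) (R al).
  case: al => [_ /= N_0|j beta /andP[hj wal] /= sal]; first by rewrite -N_0 in N0.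
  by have [h _] := Htree j hj; apply: h => //; apply: succn_inj; rewrite sal NE.
have k1N : k <= N by rewrite (leq_trans _ kN) // leq_addr.
split.
- move=> al wal sal; have [h1 h2] := top al wal sal.
  have sL : supports r (L al) by apply: suppLr; rewrite ?sal.
  have sR : supports r (R al) by apply: suppRr; rewrite ?sal.
  by split; [apply: (ci false false) | apply: (ci false true)].
- have [h1 h2 h3] := ciL false false [::] 1 N isT N0 isT
    (introT andP (conj N0 (leqnn N))) Hroot.
  by split=> //; rewrite /= ?Lx ?Ry.
- move=> al wal sal od; have := inner al wal sal; rewrite (negPf od) => -[h1 h2].
  have [_ sN] := andP sal; split.
    by apply: (ciL false false al 1 k) h1; rewrite ?k0.
  by apply: (ciL false true al (k + 1) N) h2; rewrite ?addn1 // -addn1 kN leqnn.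
move=> al wal sal od; have := inner al wal sal; rewrite od => -[h1 h2].
have [_ sN] := andP sal; split.
  by apply: (ciL true false al 1 k) h1; rewrite ?k0.
by apply: (ciL true true al (k + 1) N) h2; rewrite ?addn1 // -addn1 kN leqnn.
Qed.
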